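(* There exist an irrational number $\alpha$ and a continuous function $T:S^1\to(0,\infty)$ on the circle $S^1=\mathbb{R}/\mathbb{Z}$ such that the suspension flow $\mathrm{sus}(R_\alpha,T)$ of the rotation $R_\alpha:S^1\to S^1$, $R_\alpha(x)=x+\alpha$, with return time $T$ is kinematic expansive.
   Context: Kinematic expansive: a continuous flow $\phi=\{\phi^t\}_{t\in\mathbb{R}}$ on a compact metric space $(X,d)$ is called kinematic expansive if for any $\epsilon>0$ there is $\delta(\epsilon)>0$ such that whenever $x,y\in X$ satisfy $d(\phi^t(x),\phi^t(y))<\delta(\epsilon)$ for all $t\in\mathbb{R}$, then $y=\phi^s(x)$ for some $s\in(-\epsilon,\epsilon)$. Suspension flow: given a homeomorphism $f$ of a compact metric space $Y$ and a continuous function $T:Y\to(0,\infty)$, let $\tilde\phi^t(x,s)=(x,s+t)$ be the translation flow on $Y\times\mathbb{R}$ and let $F:Y\times\mathbb{R}\to Y\times\mathbb{R}$ be the homeomorphism $F(x,t)=(f(x),t-T(x))$. The infinite cyclic group $\langle F\rangle$ acts on $Y\times\mathbb{R}$ freely, properly discontinuously and cocompactly, and commutes with $\tilde\phi^t$ for all $t$. The suspension flow $\mathrm{sus}(f,T)$ of $f$ with return time $T$ is the flow induced by $\tilde\phi$ on the compact quotient $\langle F\rangle\setminus(Y\times\mathbb{R})$. The quotient is endowed with a metric $d$ compatible with its topology (by compactness, kinematic expansiveness does not depend on the choice of such a metric). *)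

(* Defs.v *)
From HB Require Import structures.
From mathcomp Require Import all_boot all_order all_algebra.
From mathcomp Require Import archimedean generic_quotient ring_quotient zify.
From mathcomp Require Import all_classical all_reals all_analysis.

Set Implicit Arguments.
Unset Strict Implicit.
Unset Printing Implicit Defensive.

Import Order.TTheory GRing.Theory Num.Theory.
Import numFieldNormedType.Exports.

Local Open Scope classical_set_scope.
Local Open Scope ring_scope.
Local Open Scope quotient_scope.

Record homeo (X : topologicalType) := Homeo {
  homeo_fun :> X -> X ;
  homeo_inv : X -> X ;
  homeo_funK : cancel homeo_fun homeo_inv ;
  homeo_invK : cancel homeo_inv homeo_fun ;
  homeo_fun_continuous : continuous homeo_fun ;
  homeo_inv_continuous : continuous homeo_inv }.

Section OrbitSpace.
Context {X : topologicalType}.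
Implicit Types (F : homeo X) (n : int) (x y : X).

Definition homeo_iter F n x : X :=
  match n with
  | Posz k => iter k F x
  | Negz k => iter k.+1 (homeo_inv F) x
  end.

Lemma homeo_iterS F n x : homeo_iter F (n + 1) x = F (homeo_iter F n x).
Proof.
case: n => [k|[|k]].
- by have -> : k%:Z + 1 = k.+1%:Z by lia.
- by rewrite /= homeo_invK.
- have -> : Negz k.+1 + 1 = Negz k by lia.
  by rewrite /= homeo_invK.
Qed.

Lemma homeo_iterD F m n x :
  homeo_iter F (m + n) x = homeo_iter F m (homeo_iter F n x).
Proof.
elim: m => [|k IH|k IH]; first by rewrite add0r.
- have -> : k.+1%:Z + n = (k%:Z + n) + 1 by lia.
  have -> : k.+1%:Z = k%:Z + 1 by lia.
  by rewrite !homeo_iterS IH.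
- apply: (can_inj (homeo_funK F)); rewrite -!homeo_iterS.
  have -> : - k.+1%:Z + n + 1 = - k%:Z + n by lia.
  by have -> : - k.+1%:Z + 1 = - k%:Z by lia.
Qed.

Lemma homeo_iter_continuous F n : continuous (homeo_iter F n).
Proof.
have it (g : X -> X) k : continuous g -> continuous (iter k g).
  move=> cg; elim: k => [|k IH] x; first exact: cvg_id.
  exact: (continuous_comp (IH x) (cg _)).
by case: n => k; apply: it; [exact: homeo_fun_continuous
                            |exact: homeo_inv_continuous].
Qed.

Definition same_orbit F : rel X := fun x y => `[< exists n, homeo_iter F n x = y >].

Lemma same_orbit_equiv F : equiv_class_of (same_orbit F).
Proof.
have sym x y : same_orbit F x y -> same_orbit F y x.
  move=> /asboolP[n <-]; apply/asboolP; exists (- n).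
  by rewrite -homeo_iterD addNr.
split=> [x|x y|y x z].
- by apply/asboolP; exists 0.
- by apply/idP/idP; exact: sym.
- move=> /asboolP[m <-] /asboolP[n <-]; apply/asboolP; exists (n + m).
  exact: homeo_iterD.
Qed.

Canonical same_orbit_equiv_rel F := EquivRelPack (same_orbit_equiv F).
Canonical same_orbit_encModRel F := defaultEncModRel (same_orbit F).

Definition orbit_space F := {eq_quot same_orbit F}.

HB.instance Definition _ F :=
  Topological.copy (orbit_space F) (quotient_topology (orbit_space F)).
HB.instance Definition _ F := Quotient.on (orbit_space F).

Lemma orbit_spaceP F x y :
  \pi_(orbit_space F) x = \pi_(orbit_space F) y <->
  exists n, homeo_iter F n x = y.
Proof.
by split=> [/eqmodP/asboolP|xy] //; apply/eqmodP/asboolP.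
Qed.

Lemma orbit_space_pi_open F (U : set X) :
  open U -> open (\pi_(orbit_space F) @` U).
Proof.
move=> oU; rewrite /open/= /quotient_open.
rewrite (_ : _ @^-1` _ = \bigcup_n (homeo_iter F n @^-1` U)).
  by apply: bigcup_open => n _; apply: open_comp => // x _; exact: homeo_iter_continuous.
apply/seteqP; split=> [x [y Uy /esym/orbit_spaceP[n xy]]|x [n _ Ux]].
  by exists n => //=; rewrite xy.
by exists (homeo_iter F n x) => //; apply/esym/orbit_spaceP; exists n.
Qed.

End OrbitSpace.

Record flow (R : realType) (X : topologicalType) := Flow {
  flow_map :> R -> X -> X ;
  flow_map0 : forall x, flow_map 0 x = x ;
  flow_mapD : forall s t x, flow_map (s + t) x = flow_map s (flow_map t x) ;
  flow_continuous : continuous (fun p : R * X => flow_map p.1 p.2) }.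

Definition is_metric (R : realType) (X : Type) (d : X -> X -> R) : Prop :=
  [/\ forall x y, d x y = 0 <-> x = y,
      forall x y, d x y = d y x
    & forall x y z, d x z <= d x y + d y z ].

Definition compatible_metric (R : realType) (X : topologicalType)
    (d : X -> X -> R) : Prop :=
  is_metric d /\
  forall A : set X, open A <->
    forall x, A x -> exists2 e : R, 0 < e & [set y | d x y < e] `<=` A.

(* [d] is meant to be a metric inducing the topology of [X]; this is a separate
   hypothesis, [compatible_metric d]. *)
Definition kinematic_expansive (R : realType) (X : topologicalType)
    (d : X -> X -> R) (phi : flow R X) : Prop :=
  forall eps : R, 0 < eps -> exists2 delta : R, 0 < delta &
    forall x y : X, (forall t : R, d (phi t x) (phi t y) < delta) ->
      exists2 s : R, - eps < s < eps & y = phi s x.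

Section Suspension.
Context {R : realType} {Y : topologicalType}.
Variables (f : homeo Y) (T : continuousType Y R).

Definition deck_fun (p : Y * R) : Y * R := (f p.1, p.2 - T p.1).
Definition deck_inv (p : Y * R) : Y * R :=
  (homeo_inv f p.1, p.2 + T (homeo_inv f p.1)).

Fact deck_funK : cancel deck_fun deck_inv.
Proof. by case=> x t; rewrite /deck_fun /deck_inv /= homeo_funK subrK. Qed.

Fact deck_invK : cancel deck_inv deck_fun.
Proof. by case=> x t; rewrite /deck_fun /deck_inv /= homeo_invK addrK. Qed.

Fact deck_fun_continuous : continuous deck_fun.
Proof.
move=> p; apply: (@cvg_pair _ _ _ _ (nbhs (f p.1)) (nbhs (p.2 - T p.1))).
  exact: (continuous_comp (@cvg_fst _ _ _ _ _) (@homeo_fun_continuous _ f _)).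
apply: cvgB; first exact: cvg_snd.
exact: (continuous_comp (@cvg_fst _ _ _ _ _) (@cts_fun _ _ T _)).
Qed.

Fact deck_inv_continuous : continuous deck_inv.
Proof.
have cf : continuous (fun p : Y * R => homeo_inv f p.1).
  by move=> p; exact: (continuous_comp (@cvg_fst _ _ _ _ _) (@homeo_inv_continuous _ f _)).
move=> p; apply: (@cvg_pair _ _ _ _ (nbhs (homeo_inv f p.1))
  (nbhs (p.2 + T (homeo_inv f p.1)))); first exact: cf.
apply: cvgD; first exact: cvg_snd.
exact: (continuous_comp (cf p) (@cts_fun _ _ T _)).
Qed.

Definition deck : homeo (Y * R)%type :=
  Homeo deck_funK deck_invK deck_fun_continuous deck_inv_continuous.

Definition translation (t : R) (p : Y * R) : Y * R := (p.1, p.2 + t).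

Lemma translation_deck_iter t n p :
  translation t (homeo_iter deck n p) = homeo_iter deck n (translation t p).
Proof.
have td q : translation t (deck q) = deck (translation t q).
  by rewrite /translation /= /deck_fun /= addrAC.
have tdV q : translation t (deck_inv q) = deck_inv (translation t q).
  by rewrite /translation /deck_inv /= addrAC.
have it (g : Y * R -> Y * R) k : (forall q, translation t (g q) = g (translation t q)) ->
    translation t (iter k g p) = iter k g (translation t p).
  by move=> tg; elim: k => //= k <-; rewrite tg.
by case: n => k; apply: it.
Qed.

Definition sus_space := orbit_space deck.

HB.instance Definition _ := Topological.on sus_space.
HB.instance Definition _ := Quotient.on sus_space.

(* Independence of the representative of the orbit [q] is [sus_mapE] below. *)
Definition sus_map (t : R) (q : sus_space) : sus_space :=
  \pi_sus_space (translation t (repr q)).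

Lemma sus_mapE t p :
  sus_map t (\pi_sus_space p) = \pi_sus_space (translation t p).
Proof.
rewrite /sus_map; have : \pi_sus_space p = \pi_sus_space (repr (\pi_sus_space p)).
  by rewrite reprK.
move=> /orbit_spaceP[n <-]; rewrite translation_deck_iter.
by apply/esym/orbit_spaceP; exists n.
Qed.

Fact sus_map0 q : sus_map 0 q = q.
Proof.
by rewrite -[q]reprK sus_mapE /translation addr0 -surjective_pairing.
Qed.

Fact sus_mapD s t q : sus_map (s + t) q = sus_map s (sus_map t q).
Proof.
rewrite -[q]reprK (sus_mapE t) !sus_mapE /translation /=.
by rewrite -addrA [t + s]addrC.
Qed.

Fact sus_map_continuous : continuous (fun p : R * sus_space => sus_map p.1 p.2).
Proof.
case=> t q; rewrite -[q]reprK; set p := repr q => A /=.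
rewrite sus_mapE => nA.
have ct : continuous (fun u : R * (Y * R) => translation u.1 u.2).
  move=> u; apply: (@cvg_pair _ _ _ _ (nbhs u.2.1) (nbhs (u.2.2 + u.1))).
    exact: (continuous_comp (@cvg_snd _ _ _ _ _) (@cvg_fst _ _ _ _ _)).
  apply: cvgD; last exact: cvg_fst.
  exact: (continuous_comp (@cvg_snd _ _ _ _ _) (@cvg_snd _ _ _ _ _)).
have /= := continuous_comp (ct (t, p)) (@pi_continuous _ _ _) nA.
case=> -[U V] /= [nU nV] UV.
move: nV; rewrite nbhsE => -[V' [oV' V'p] V'V].
exists (U, \pi_sus_space @` V') => /=.
  split => //; apply: open_nbhs_nbhs; split; first exact: orbit_space_pi_open.
  by exists p.
move=> [s _] /= [Us [v V'v <-]]; rewrite sus_mapE.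
by apply: (UV (s, v)); split => //; exact: V'V.
Qed.

Definition sus : flow R sus_space := Flow sus_map0 sus_mapD sus_map_continuous.

End Suspension.

Section Circle.
Variable R : realType.

(* [Num.int_num_subdef] is the predicate underlying the qualifier [Num.int];
   the subgroup structure is attached to it. *)
Definition integers : zmodClosed R :=
  GRing.ZmodClosed.clone R (@Num.int_num_subdef R) _.

Definition circle : Type := Quotient.quot integers.

HB.instance Definition _ := Topological.copy circle (quotient_topology circle).
HB.instance Definition _ := Quotient.on circle.
HB.instance Definition _ := GRing.isZmodule.Build circle
  (@Quotient.addqA R integers) (@Quotient.addqC R integers)
  (@Quotient.add0q R integers) (@Quotient.addNq R integers).

Lemma circleP (x y : R) : \pi_circle x = \pi_circle y <-> x - y \is a Num.int.
Proof. by split=> [/eqmodP|xy] //; apply/eqmodP. Qed.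

Lemma circle_piD (x y : R) : \pi_circle (x + y) = \pi_circle x + \pi_circle y.
Proof. exact: Quotient.pi_add. Qed.

Lemma circle_pi0 : \pi_circle 0 = 0.
Proof. by apply: (@addrI circle (\pi_circle 0)); rewrite -circle_piD !addr0. Qed.

Definition rotation_fun (a : R) (x : circle) : circle := x + \pi_circle a.

Fact rotation_funK a : cancel (rotation_fun a) (rotation_fun (- a)).
Proof.
by move=> x; rewrite /rotation_fun -addrA -circle_piD subrr circle_pi0 addr0.
Qed.

Fact rotation_invK a : cancel (rotation_fun (- a)) (rotation_fun a).
Proof. by move=> x; rewrite -{2}[x](rotation_funK (- a)) opprK. Qed.

Fact rotation_fun_continuous a : continuous (rotation_fun a).
Proof.
apply/quotient_continuous.
rewrite (_ : _ \o _ = \pi_circle \o (fun x : R => x + a)).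
  move=> x; apply: continuous_comp; last exact: pi_continuous.
  by apply: cvgD; [exact: cvg_id|exact: cvg_cst].
by apply/funext => x /=; rewrite /rotation_fun circle_piD.
Qed.

Definition rotation (a : R) : homeo circle :=
  Homeo (rotation_funK a) (rotation_invK a)
    (@rotation_fun_continuous a) (@rotation_fun_continuous (- a)).

End Circle.

(* Main.v *)
(** Take alpha the golden mean, so that alpha^2 = 1 - alpha and the Fibonacci
numbers m_j = 1, 2, 3, 5, ... satisfy ||m_j alpha|| = alpha^(j+2), and let
T(x) = const + sum_j alpha^j cos(2 pi m_j x).

If two points of the suspension stay close, then, up to a deck transformation,
their lifts (x, s) and (x + h, s') stay close in the cover, so |s' - s| and all
the differences of Birkhoff sums S_n T(x + h) - S_n T(x) are small.  Averaging
T(x + h + n alpha) - T(x + n alpha) against the m_J-th harmonic along the orbit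
gives alpha^J |sin(pi m_J h)|, while a summation by parts bounds this average by
a small multiple of |sin(pi m_J alpha)|, which is at most pi alpha^J.  Hence m_J h
is close to an integer, uniformly in J.  As m_0 = 1 and m_(J+1) <= 2 m_J, induction
on J shows that m_J |h| itself is small, for |h| <= 1/2; so h = 0.

For the topology, the cover Y x R carries a metric, compatible and invariant under
the deck transformation F: the distance of the base points plus the supremum over n
of the differences of the clamped heights of F^n p and F^n q.  Distinct points of an
orbit of F are uniformly separated, so the infimum over lifts is a compatible metric
on the compact quotient, and any other one is uniformly equivalent to it. *)

Require Import Defs.
From HB Require Import structures.
From mathcomp Require Import all_boot all_order all_algebra.
From mathcomp Require Import archimedean generic_quotient zify ring lra.
From mathcomp Require Import all_classical all_reals all_analysis.

Set Implicit Arguments.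
Unset Strict Implicit.
Unset Printing Implicit Defensive.

Import Order.TTheory GRing.Theory Num.Theory.
Import numFieldNormedType.Exports.

Local Open Scope classical_set_scope.
Local Open Scope ring_scope.

(** * Metrics on quotients by a homeomorphism *)

Section Metrics.
Context {R : realType}.

Lemma metric_refl (X : Type) (d : X -> X -> R) x : is_metric d -> d x x = 0.
Proof. by move=> [d0 _ _]; apply/d0. Qed.

Lemma metric_ge0 (X : Type) (d : X -> X -> R) x y : is_metric d -> 0 <= d x y.
Proof.
move=> dm; have := metric_refl x dm; case: dm => _ dC dT.
have := dT x y x; rewrite (dC y x); lra.
Qed.

Lemma compatible_nbhsP (X : topologicalType) (d : X -> X -> R) x (A : set X) :
  compatible_metric d ->
  nbhs x A <-> exists2 e, 0 < e & [set y | d x y < e] `<=` A.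
Proof.
move=> [dm dA]; have dxx := metric_refl _ dm.
case: (dm) => _ _ dT; split.
  rewrite nbhsE => -[B [/dA oB Bx] BA].
  by have [e e0 eB] := oB _ Bx; exists e => //; apply: subset_trans BA.
move=> [e e0 eA]; rewrite nbhsE; exists [set y | d x y < e] => //.
split; last by rewrite /= dxx.
apply/dA => y /= dxy; exists (e - d x y) => [|z /=]; first lra.
have := dT x y z; lra.
Qed.

Lemma compatible_metricP (X : topologicalType) (d : X -> X -> R) :
  is_metric d ->
  (forall x A, nbhs x A <-> exists2 e, 0 < e & [set y | d x y < e] `<=` A) ->
  compatible_metric d.
Proof.
move=> dm dA; split=> // A; rewrite openE.
by split=> oA x Ax; apply/dA; exact: oA.
Qed.

(** Continuity of the identity at each point gives a radius, half of which serves all nearby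
    centres; the near-covering form of compactness makes it uniform. This allows an arbitrary
    compatible metric on the suspension to be traded for an explicit one. *)
Lemma compact_metric_unif (X : topologicalType) (d d' : X -> X -> R) (e : R) :
  compact [set: X] -> compatible_metric d -> compatible_metric d' -> 0 < e ->
  exists2 delta, 0 < delta & forall x y, d x y < delta -> d' x y < e.
Proof.
move=> /compact_near_coveringP cX cd cd' e0.
have [[_ dC dT] [_ dC' dT']] := (cd.1, cd'.1).
have : \forall i \near 0^'+, [set: X] `<=` [set x | forall y, d x y < i -> d' x y < e].
  apply: cX => x _.
  have nb' := (compatible_nbhsP x [set y | d' x y < e / 2] cd').2.
  have /(compatible_nbhsP _ _ cd)[r r0 rA] : nbhs x [set y | d' x y < e / 2].
    by apply: nb'; exists (e / 2) => //; rewrite divr_gt0.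
  exists ([set y | d x y < r / 2], [set i : R | i < r / 2]) => /=.
    split; last by apply: nbhs_right_lt; rewrite divr_gt0.
    by apply/(compatible_nbhsP _ _ cd); exists (r / 2) => //; rewrite divr_gt0.
  move=> [z i] /= [xz ir] y zy.
  have xz' : d' x z < e / 2 by apply: rA => /=; lra.
  have xy' : d' x y < e / 2.
    by apply: rA => /=; have := dT x z y; lra.
  by have := dT' z x y; rewrite (dC' z x); lra.
move=> H; near (0 : R)^'+ => i.
exists i => //.
have iP : [set: X] `<=` [set x | forall y, d x y < i -> d' x y < e] by near: i.
by move=> x y; apply: (iP x).
Unshelve. all: end_near.
Qed.

End Metrics.

Section OrbitMetric.
Context {R : realType} {X : topologicalType}.
Variables (F : homeo X) (D : X -> X -> R) (c : R).
Hypothesis c0 : 0 < c.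
Hypothesis cD : compatible_metric D.
Hypothesis DF : forall x y, D (F x) (F y) = D x y.
Hypothesis Dc : forall n x, n != 0 -> c <= D x (homeo_iter F n x).

Lemma isometry_iter n x y : D (homeo_iter F n x) (homeo_iter F n y) = D x y.
Proof.
have DFV u v : D (homeo_inv F u) (homeo_inv F v) = D u v.
  by rewrite -DF !homeo_invK.
by case: n => k /=; [elim: k => //= k <-; rewrite DF|
  rewrite DFV; elim: k => //= k <-; rewrite DFV].
Qed.

Local Notation pi := (\pi_(orbit_space F)%qT).

(** Only the lift of [b] varies: as [F] is an isometry of [D], this is the infimum over all pairs of
    lifts. *)
Definition orbit_dist (a b : orbit_space F) : R :=
  inf (range (fun n => D (repr a) (homeo_iter F n (repr b)))).

Lemma orbit_dist_ltP x y e :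
  orbit_dist (pi x) (pi y) < e <-> exists n, D x (homeo_iter F n y) < e.
Proof.
have [m mx] : exists m, homeo_iter F m (repr (pi x)) = x.
  by apply/orbit_spaceP; rewrite reprK.
have [k ky] : exists k, homeo_iter F k (repr (pi y)) = y.
  by apply/orbit_spaceP; rewrite reprK.
have hl : has_lbound (range (fun n => D (repr (pi x)) (homeo_iter F n (repr (pi y))))).
  by exists 0 => _ [n _ <-]; exact: metric_ge0 cD.1.
split.
  move=> xye; have [|_ [n _ <-] ne] := inf_lt _ xye.
    by exists (D (repr (pi x)) (homeo_iter F 0 (repr (pi y)))), 0.
  exists (m + n - k); rewrite -{1}mx -{1}ky -homeo_iterD subrK homeo_iterD.
  by rewrite isometry_iter.
move=> [n]; rewrite -{1}mx -{1}ky -homeo_iterD => ne.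
apply: le_lt_trans ne; apply: (ge_inf hl); exists (- m + (n + k)) => //.
by rewrite -(isometry_iter m) -homeo_iterD addrA subrr add0r.
Qed.

Lemma orbit_dist_ge0 a b : 0 <= orbit_dist a b.
Proof.
apply: lb_le_inf => [|_ [n _ <-]]; last exact: metric_ge0 cD.1.
by exists (D (repr a) (homeo_iter F 0 (repr b))), 0.
Qed.

Lemma orbit_dist_metric : is_metric orbit_dist.
Proof.
have [D0 DC DT] := cD.1.
have dle a b : orbit_dist a b <= orbit_dist b a.
  rewrite -[a]reprK -[b]reprK; apply/ler_addgt0Pr => e e0.
  have [|n] := (orbit_dist_ltP (repr b) (repr a) (orbit_dist (pi (repr b)) (pi (repr a)) + e)).1.
    by rewrite ltrDl.
  move=> ne; apply/ltW/orbit_dist_ltP; exists (- n).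
  by rewrite -(isometry_iter n) -homeo_iterD subrr DC.
split.
- move=> a b; split=> [ab|->]; last first.
    apply/eqP; rewrite eq_le orbit_dist_ge0 andbT -[b]reprK.
    apply/ler_addgt0Pr => e e0; rewrite add0r; apply/ltW/orbit_dist_ltP.
    by exists 0; rewrite metric_refl //; exact: cD.1.
  rewrite -[a]reprK -[b]reprK in ab *; set x := repr a in ab *; set y := repr b in ab *.
  (* The infimum could fail to be attained. But two lifts of [b] within [c / 2] of [x] coincide by
     [Dc], so this single lift is arbitrarily close to [x], hence equal to it. *)
  have [|n nc] := (orbit_dist_ltP x y (c / 2)).1; first by rewrite ab divr_gt0.
  apply/esym/orbit_spaceP; exists n; apply/esym/D0/eqP.
  rewrite eq_le (metric_ge0 _ _ cD.1) andbT; apply/ler_addgt0Pr => e e0.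
  rewrite add0r leNgt; apply/negP => en.
  have [|m mc] := (orbit_dist_ltP x y (Num.min e (c / 2))).1.
    by rewrite ab lt_min e0 divr_gt0.
  have mn : m != n by apply: contraL mc => /eqP ->; rewrite -leNgt ge_min ltW.
  move: mc; rewrite lt_min => /andP[_ mc].
  have := @Dc (m - n) (homeo_iter F n y); rewrite subr_eq0 => /(_ mn).
  rewrite -homeo_iterD subrK => cc.
  have := DT (homeo_iter F n y) x (homeo_iter F m y).
  by rewrite (DC _ x); lra.
- by move=> a b; apply/eqP; rewrite eq_le !dle.
- move=> a b e; rewrite -[a]reprK -[b]reprK -[e]reprK.
  set x := repr a; set y := repr b; set z := repr e.
  apply/ler_addgt0Pr => t t0.
  have [|n nt] := (orbit_dist_ltP x y (orbit_dist (pi x) (pi y) + t / 2)).1.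
    by rewrite ltrDl divr_gt0.
  have [|m mt] := (orbit_dist_ltP y z (orbit_dist (pi y) (pi z) + t / 2)).1.
    by rewrite ltrDl divr_gt0.
  apply/ltW/orbit_dist_ltP; exists (n + m); rewrite homeo_iterD.
  have := DT x (homeo_iter F n y) (homeo_iter F n (homeo_iter F m z)).
  by rewrite isometry_iter; lra.
Qed.

Lemma orbit_dist_compatible : compatible_metric orbit_dist.
Proof.
have [D0 DC DT] := cD.1.
split=> [|A]; first exact: orbit_dist_metric.
rewrite [open A](_ : _ = open (pi @^-1` A)) //.
have oP := cD.2 (pi @^-1` A).
split.
  move=> /oP oA a; rewrite -[a]reprK => Aa.
  have [e e0 eA] := oA _ Aa; exists e => // b /=.
  rewrite -[b]reprK => /orbit_dist_ltP[n ne].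
  have /= := eA _ ne; congr A; apply/esym/orbit_spaceP; by exists n.
move=> oA; apply/oP => x /= Ax.
have [e e0 eA] := oA _ Ax; exists e => // y /= xy.
by apply: eA; apply/orbit_dist_ltP; exists 0.
Qed.

End OrbitMetric.

(** * The metric of a suspension *)

Section SusMetric.
Context {R : realType} {Y : topologicalType}.
Variables (f : homeo Y) (T : continuousType Y R) (rho : Y -> Y -> R) (c C : R).
Hypothesis c0 : 0 < c.
Hypothesis cT : forall x, c <= T x.
Hypothesis TC : forall x, T x <= C.
Hypothesis crho : compatible_metric rho.
Hypothesis rhof : forall x y, rho (f x) (f y) = rho x y.

Local Notation dk := (deck f T).
Implicit Types (n m : int) (k : nat) (p q : Y * R).

(** For [n >= 0] this is [p.2] minus the [n]-th Birkhoff sum of [T] at [p.1]. Differences of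
    Birkhoff sums are thus read off from heights. *)
Definition height n p : R := (homeo_iter dk n p).2.

Lemma heightS n p : height (n + 1) p = height n p - T (homeo_iter dk n p).1.
Proof. by rewrite /height homeo_iterS. Qed.

Lemma height_iter n m p : height n (homeo_iter dk m p) = height (n + m) p.
Proof. by rewrite /height homeo_iterD. Qed.

Lemma height_deck n p : height n (dk p) = height (n + 1) p.
Proof. exact: height_iter n 1 p. Qed.

Lemma height_translation n t p : height n (translation t p) = height n p + t.
Proof. by rewrite /height -translation_deck_iter. Qed.

Lemma height_drop n k p : k%:R * c <= height n p - height (n + k%:Z) p <= k%:R * C.
Proof.
elim: k => [|k /andP[lo hi]]; first by rewrite addr0 subrr !mul0r lexx.
have -> : n + k.+1%:Z = n + k%:Z + 1 by lia.
rewrite heightS -natr1.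
have := cT (homeo_iter dk (n + k%:Z) p).1; have := TC (homeo_iter dk (n + k%:Z) p).1.
by move=> ? ?; apply/andP; split; lra.
Qed.

Lemma height_sep n m p : n != m -> c <= `|height n p - height m p|.
Proof.
wlog nm : n m / (n < m)%R => [H nm|_].
  have [/H->//|/H|/eqP] := ltgtP n m; last by rewrite (negPf nm).
  by rewrite distrC eq_sym => ->.
have [k mE] : exists k : nat, m = n + k.+1%:Z by exists (`|m - n|.-1)%N; lia.
have /andP[+ _] := height_drop n k.+1 p; rewrite -mE -natr1 => H.
have : 0 <= k%:R * c by rewrite mulr_ge0 // ltW.
by move=> kc; apply: le_trans (ler_norm _); lra.
Qed.

Lemma return_bound_gt0 (x : Y) : 0 < C.
Proof. exact: lt_le_trans c0 (le_trans (cT x) (TC x)). Qed.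

(** Heights are unbounded above and each step descends by at least [c] and at most [C], so a descent
    cannot jump over a window of length [C]. *)
Lemma height_window p : exists n, C <= height n p <= 2 * C.
Proof.
have C0 := return_bound_gt0 p.1.
(* Here [k] counts the multiples of [c] by which the height may exceed the window; a step taken from
   above [2 * C] lands above [C] and uses up one of them. *)
have start k n : C <= height n p <= 2 * C + k%:R * c ->
    exists m, C <= height m p <= 2 * C.
  elim: k n => [|k IH] n; first by rewrite mul0r addr0; exists n.
  have [n2|n2] := leP (height n p) (2 * C).
    by move=> /andP[n1 _]; exists n; rewrite n1.
  rewrite -natr1 => /andP[_ nk]; apply: (IH (n + 1)); rewrite heightS.
  have := cT (homeo_iter dk n p).1; have := TC (homeo_iter dk n p).1.
  by move=> ? ?; apply/andP; split; lra.
have [n nC] : exists n, C <= height n p.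
  pose k := Num.truncn (`|C - height 0 p| / c).
  exists (- k.+1%:Z); have /andP[+ _] := height_drop (- k.+1%:Z) k.+1 p.
  rewrite addNr => H.
  have : `|C - height 0 p| / c < k.+1%:R by exact: truncnS_gt.
  rewrite ltr_pdivrMr // => H'; have := ler_norm (C - height 0 p); lra.
pose k := Num.truncn (`|height n p| / c).
apply: (start k.+1 n); rewrite nC /=.
have : `|height n p| / c < k.+1%:R by exact: truncnS_gt.
rewrite ltr_pdivrMr // => H'; have := ler_norm (height n p); lra.
Qed.

(** Truncation to [[0, 3C]] keeps the supremum over all iterates finite, and leaves a margin [C] on
    each side of the window [[C, 2C]]. *)
Definition clamp (x : R) : R := Num.min (Num.max x 0) (3 * C).

Lemma clamp_lipschitz x y : `|clamp x - clamp y| <= `|x - y|.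
Proof.
have -> : clamp x = (if x < 0 then Num.min 0 (3 * C) else Num.min x (3 * C)).
  by rewrite /clamp; case: ltP.
have -> : clamp y = (if y < 0 then Num.min 0 (3 * C) else Num.min y (3 * C)).
  by rewrite /clamp; case: ltP.
have := ler_norm (x - y); have := ler_norm (- (x - y)); rewrite normrN => ? ?.
by rewrite ler_norml !minElt; do 4?case: ifPn; rewrite -?leNgt => *; apply/andP; split; lra.
Qed.

Lemma clamp_bounded x y : 0 <= C -> `|clamp x - clamp y| <= 3 * C.
Proof.
move=> C0; have H z : 0 <= clamp z <= 3 * C.
  by rewrite /clamp le_min ge_min le_max !lexx !orbT /= mulr_ge0.
have /andP[? ?] := H x; have /andP[? ?] := H y.
by rewrite ler_norml; apply/andP; split; lra.
Qed.

(** If truncation altered [y], the truncated values would already be at least [C] apart, because of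
    the margin around the window. *)
Lemma clamp_window x y (e : R) : C <= x <= 2 * C -> e <= C ->
  `|clamp x - clamp y| < e -> `|x - y| < e.
Proof.
move=> /andP[x1 x2] eC; have -> : clamp x = x by rewrite /clamp max_l ?min_l; lra.
have [y0|y0] := ltP y 0.
  have -> : clamp y = 0 by rewrite /clamp max_r ?min_l; lra.
  by rewrite subr0 => /(le_lt_trans (ler_norm x)); lra.
have [y3|y3] := ltP (3 * C) y.
  have -> : clamp y = 3 * C by rewrite /clamp max_l ?min_r; lra.
  by rewrite ltr_norml => /andP[? ?]; lra.
by have -> : clamp y = y by rewrite /clamp max_l ?min_l; lra.
Qed.

(* Away from finitely many [n] the heights of [p] and of all nearby points are
   clamped to the same value; this makes the supremum continuous. *)
Definition height_dist p q : R :=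
  sup (range (fun n => `|clamp (height n p) - clamp (height n q)|)).

Lemma height_dist_ub n p q :
  `|clamp (height n p) - clamp (height n q)| <= height_dist p q.
Proof.
have C0 := return_bound_gt0 p.1.
apply: ub_le_sup; last by exists n.
by exists (3 * C) => _ [m _ <-]; apply: clamp_bounded; exact: ltW.
Qed.

Lemma height_dist_le p q e :
  (forall n, `|clamp (height n p) - clamp (height n q)| <= e) -> height_dist p q <= e.
Proof.
move=> H; apply: ge_sup => [|_ [n _ <-]]; last exact: H.
by exists (`|clamp (height 0 p) - clamp (height 0 q)|), 0.
Qed.

Lemma height_dist_ge0 p q : 0 <= height_dist p q.
Proof. by apply: le_trans (height_dist_ub 0 p q). Qed.

Definition cover_dist p q : R := rho p.1 q.1 + height_dist p q.

Lemma height_dist_cover p q : height_dist p q <= cover_dist p q.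
Proof. by rewrite lerDr; exact: metric_ge0 crho.1. Qed.

Lemma cover_dist_height n p q e : C <= height n p <= 2 * C -> e <= C ->
  cover_dist p q < e -> `|height n p - height n q| < e.
Proof.
move=> pC eC pqe; apply: (clamp_window pC eC).
exact: le_lt_trans (height_dist_ub n p q) (le_lt_trans (height_dist_cover p q) pqe).
Qed.

Lemma cover_dist_deck p q : cover_dist (dk p) (dk q) = cover_dist p q.
Proof.
rewrite /cover_dist /= rhof; congr (_ + _).
apply/eqP; rewrite eq_le; apply/andP; split; apply: height_dist_le => n.
  by rewrite !height_deck; exact: height_dist_ub.
by have := height_dist_ub (n - 1) (dk p) (dk q); rewrite !height_deck subrK.
Qed.

(** At an index where the height of [p] lies in the window truncation is harmless, and there the
    heights of the two points are those of [p] at distinct indices. *)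
Lemma cover_dist_iter n p : n != 0 -> c <= cover_dist p (homeo_iter dk n p).
Proof.
move=> n0; have [m mC] := height_window p.
have := cT p.1; have := TC p.1 => T1 T2.
rewrite leNgt; apply/negP => /(cover_dist_height mC) H.
have {H} := H (le_trans T2 T1); rewrite height_iter ltNge => /negP; apply.
by apply: height_sep; lia.
Qed.

Lemma cover_dist_translation p q t :
  cover_dist (translation t p) (translation t q) <= cover_dist p q + 2 * `|t|.
Proof.
rewrite /cover_dist /= -addrA lerD2l; apply: height_dist_le => n.
rewrite !height_translation; have := height_dist_ub n p q.
have := clamp_lipschitz (height n p + t) (height n p).
have := clamp_lipschitz (height n q) (height n q + t).
rewrite opprD addNKr normrN addrAC subrr add0r.
set a := clamp (height n p); set b := clamp (height n q).
set a' := clamp (height n p + t); set b' := clamp (height n q + t) => H1 H2 H3.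
have -> : a' - b' = a' - a + (a - b) + (b - b') by ring.
have := ler_normD (a' - a + (a - b)) (b - b'); have := ler_normD (a' - a) (a - b); lra.
Qed.

Lemma cover_dist_metric : is_metric cover_dist.
Proof.
have [r0 rC rT] := crho.1.
split.
- move=> p q; split=> [pq|->]; last first.
    rewrite /cover_dist (metric_refl _ crho.1) add0r; apply/eqP.
    rewrite eq_le height_dist_ge0 andbT; apply: height_dist_le => n.
    by rewrite subrr normr0.
  have r1 := metric_ge0 p.1 q.1 crho.1; have h1 := height_dist_ge0 p q.
  have pq1 : p.1 = q.1 by apply/r0; move: pq; rewrite /cover_dist; lra.
  suff pq2 : p.2 = q.2 by rewrite [p]surjective_pairing pq1 pq2 -surjective_pairing.
  (* Over a common base point all heights of [p] and [q] differ by the same constant, so one index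
     in the window suffices to recover it. *)
  have [n nC] := height_window p.
  have qE : q = translation (q.2 - p.2) p.
    by rewrite /translation pq1 addrC subrK -surjective_pairing.
  apply/eqP; rewrite -subr_eq0 -normr_le0; apply/ler_addgt0Pr => e e0; rewrite add0r.
  have C0 := return_bound_gt0 p.1.
  have := @cover_dist_height n p q (Num.min e C) nC.
  rewrite pq ge_min lexx orbT lt_min e0 C0 {1}qE height_translation => /(_ isT isT).
  by rewrite opprD addNKr opprB lt_min => /andP[/ltW].
- move=> p q; rewrite /cover_dist rC; congr (_ + _).
  by apply/eqP; rewrite eq_le; apply/andP; split; apply: height_dist_le => n;
    rewrite distrC; exact: height_dist_ub.
- move=> p q r; rewrite /cover_dist addrACA; apply: lerD; first exact: rT.
  apply: height_dist_le => n.
  apply: le_trans (ler_distD (clamp (height n q)) _ _) _.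
  by apply: lerD; exact: height_dist_ub.
Qed.

Lemma height_continuous n : continuous (height n).
Proof.
move=> p; apply: (@continuous_comp _ _ _ (homeo_iter dk n) snd).
  exact: homeo_iter_continuous.
exact: cvg_snd.
Qed.

Lemma heightE n p : height n p = height n (p.1, 0) + p.2.
Proof. by rewrite -height_translation /translation /= add0r -surjective_pairing. Qed.

Lemma cover_dist_nbhs p (A : set (Y * R)) :
  nbhs p A <-> exists2 e, 0 < e & [set q | cover_dist p q < e] `<=` A.
Proof.
have C0 := return_bound_gt0 p.1.
split.
  case=> -[U V] /= [pU pV] UVA.
  (* Closeness of the [n]-th heights, with continuity of [height n] in the base point, controls the
     second coordinate. *)
  have [n nC] := height_window p.
  move: pV => /nbhs_ballP[v v0 vV].
  have : nbhs p.1 [set y | U y /\ `|height n (p.1, 0) - height n (y, 0)| < v / 2].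
    apply: filterI => //; have v20 : 0 < v / 2 by rewrite divr_gt0.
    have cy : continuous (fun y : Y => height n (y, 0)).
      move=> y; apply: (@continuous_comp _ _ _ (fun y : Y => (y, 0 : R))).
        by apply: (@cvg_pair _ _ _ _ (nbhs y) (nbhs (0 : R))); [exact: cvg_id|exact: cvg_cst].
      exact: height_continuous.
    by have /cvgrPdist_lt/(_ _ v20) := cy p.1.
  move=> /(compatible_nbhsP _ _ crho)[r r0 rU].
  exists (Num.min r (Num.min C (v / 2))); first by rewrite !lt_min r0 C0 divr_gt0.
  move=> q /=; rewrite !lt_min => /and3P[pqr pqC pqv].
  have pq : cover_dist p q < Num.min C (v / 2) by rewrite lt_min pqC.
  have := cover_dist_height nC _ pq; rewrite ge_min lexx lt_min => /(_ isT) /andP[_ hv].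
  have [] := rU q.1 _.
    by apply: le_lt_trans pqr; rewrite /= lerDl height_dist_ge0.
  move=> Uq qv; apply: UVA; split => //; apply: vV; rewrite /ball /=.
  move: hv qv; rewrite (heightE n p) (heightE n q).
  rewrite !ltr_norml => /andP[? ?] /andP[? ?]; apply/andP; split; lra.
move=> [e e0 eA]; apply: filterS eA _.
have e20 : 0 < e / 2 by rewrite divr_gt0.
have n1 : \forall q \near p, rho p.1 q.1 < e / 2.
  exists ([set y | rho p.1 y < e / 2], setT) => /= [|z []//]; split; last exact: filterT.
  by apply/(compatible_nbhsP _ _ crho); exists (e / 2).
have n2 : \forall q \near p, `|p.2 - q.2| < 1.
  exists (setT, ball p.2 1) => /= [|z []//]; split; first exact: filterT.
  exact: nbhsx_ballx.
(* Beyond [N] steps in either direction every point with second coordinate within 1 of [p.2] has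
   left [[0, 3C]], so only finitely many heights have to be compared. *)
pose N := (Num.truncn ((`|p.2| + 1 + 3 * C) / c)).+1.
have Nc : `|p.2| + 1 + 3 * C < N%:R * c.
  by rewrite -ltr_pdivrMr //; exact: truncnS_gt.
have nh n : \forall q \near p, `|height n p - height n q| < e / 3.
  have e30 : 0 < e / 3 by rewrite divr_gt0.
  by have /cvgrPdist_lt/(_ _ e30) := @height_continuous n p.
have n3 := filter_forall (nbhs_filter p) (fun i : 'I_N => nh i%:Z).
have n4 := filter_forall (nbhs_filter p) (fun i : 'I_N => nh (- i%:Z)).
have h0 q : height 0 q = q.2 by [].
have up k q : `|p.2 - q.2| < 1 -> (N <= k)%N -> clamp (height k%:Z q) = 0.
  move=> pq Nk; have /andP[+ _] := height_drop 0 k q; rewrite add0r h0 => H.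
  have : N%:R * c <= k%:R * c by rewrite ler_pM2r // ler_nat.
  have := ler_norm p.2; move: pq; rewrite ltr_norml => /andP[? ?] ? ?.
  by rewrite /clamp max_r ?min_l; lra.
have dn k q : `|p.2 - q.2| < 1 -> (N <= k)%N -> clamp (height (- k%:Z) q) = 3 * C.
  move=> pq Nk; have /andP[+ _] := height_drop (- k%:Z) k q; rewrite addNr h0 => H.
  have : N%:R * c <= k%:R * c by rewrite ler_pM2r // ler_nat.
  have := ler_norm (- p.2); rewrite normrN; move: pq; rewrite ltr_norml => /andP[? ?] ? ?.
  by rewrite /clamp max_l ?min_r; lra.
near=> q.
have q1 : rho p.1 q.1 < e / 2 by near: q.
have q2 : `|p.2 - q.2| < 1 by near: q.
have q3 : forall i : 'I_N, `|height i%:Z p - height i%:Z q| < e / 3 by near: q.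
have q4 : forall i : 'I_N, `|height (- i%:Z) p - height (- i%:Z) q| < e / 3 by near: q.
have p2 : `|p.2 - p.2| < 1 by rewrite subrr normr0.
suff : height_dist p q <= e / 3 by rewrite /= /cover_dist; lra.
apply: height_dist_le => n.
have [[k ->]|[k ->]] : (exists k : nat, n = k%:Z) \/ (exists k : nat, n = - k%:Z).
  by case: n => k; [left; exists k|right; exists k.+1].
- have [Nk|kN] := leqP N k.
    by rewrite !up // subrr normr0 divr_ge0 // ltW.
  by apply: le_trans (clamp_lipschitz _ _) _; have := q3 (Ordinal kN); exact: ltW.
- have [Nk|kN] := leqP N k.
    by rewrite !dn // subrr normr0 divr_ge0 // ltW.
  by apply: le_trans (clamp_lipschitz _ _) _; have := q4 (Ordinal kN); exact: ltW.
Unshelve. all: end_near.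
Qed.

Lemma cover_dist_compatible : compatible_metric cover_dist.
Proof. exact: compatible_metricP cover_dist_metric cover_dist_nbhs. Qed.

Definition sus_dist : sus_space f T -> sus_space f T -> R :=
  @orbit_dist _ _ dk cover_dist.

Lemma sus_dist_compatible : compatible_metric sus_dist.
Proof.
exact: (orbit_dist_compatible c0 cover_dist_compatible cover_dist_deck cover_dist_iter).
Qed.

Lemma sus_space_compact : compact [set: Y] -> compact [set: sus_space f T].
Proof.
move=> cY.
have -> : [set: sus_space f T] = \pi_(sus_space f T)%qT @` ([set: Y] `*` `[0, 2 * C]).
  apply/seteqP; split=> // a _; rewrite -[a]reprK; set p := repr a.
  have [n /andP[n1 n2]] := height_window p.
  exists (homeo_iter dk n p); last by apply/esym/orbit_spaceP; exists n.
  split => //=; rewrite in_itv /=; apply/andP; split => //.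
  by apply: le_trans n1; exact: ltW (return_bound_gt0 p.1).
apply: continuous_compact.
  by apply: continuous_subspaceT => x; exact: pi_continuous.
by apply: compact_setX => //; exact: segment_compact.
Qed.

(* The lift realizing the distance cannot change along the flow: two distinct
   lifts of a point are [c] apart, and [cover_dist] varies slowly in [t]. *)
Lemma lift_stays_close p q e : 0 < e -> 4 * e <= c ->
  (forall t, sus_dist (sus f T t (\pi_(sus_space f T)%qT p))
                      (sus f T t (\pi_(sus_space f T)%qT q)) < e) ->
  cover_dist p q < e ->
  forall t, cover_dist (translation t p) (translation t q) < e.
Proof.
move=> e0 ec pqe.
have [_ DC DT] := cover_dist_metric.
have step t p' q' : `|t| <= e / 2 ->
    (forall t, sus_dist (sus f T t (\pi_(sus_space f T)%qT p'))
                      (sus f T t (\pi_(sus_space f T)%qT q')) < e) ->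
    cover_dist p' q' < e -> cover_dist (translation t p') (translation t q') < e.
  move=> te /(_ t); rewrite /= !sus_mapE => H pq'.
  have [n nE] := (orbit_dist_ltP cover_dist_compatible cover_dist_deck _ _ _).1 H.
  (* Another lift would be at distance less than [2 * e + e] from [translation t q'], where [2 * e]
     bounds the drift of the original pair; this contradicts [4 * e <= c]. *)
  have [n0|n0] := eqVneq n 0; first by move: nE; rewrite n0.
  have := cover_dist_iter (translation t q') n0.
  have := DT (translation t q') (translation t p') (homeo_iter dk n (translation t q')).
  have := cover_dist_translation p' q' t.
  rewrite (DC (translation t q') (translation t p')); lra.
have trD s t r : translation s (translation t r) = translation (t + s) r :> Y * R.
  by rewrite /translation /= addrA.
have steps u k : `|u| <= e / 2 -> cover_dist p q < e ->
    cover_dist (translation (k%:R * u) p) (translation (k%:R * u) q) < e.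
  move=> ue pq'; elim: k => [|k IH].
    by rewrite mul0r /translation !addr0 -!surjective_pairing.
  rewrite -natr1 mulrDl mul1r -!trD; apply: step => // t.
  rewrite /= !sus_mapE !trD; have := pqe (k%:R * u + t).
  by rewrite /= !sus_mapE.
move=> pq' t; pose k := (Num.truncn (`|t| / (e / 2))).+1.
have k0 : (0 : R) < k%:R by [].
have := steps (t / k%:R) k _ pq'; rewrite mulrCA mulfV ?gt_eqF // mulr1; apply.
rewrite normrM normfV (gtr0_norm k0) ler_pdivrMr // mulrC -ler_pdivrMr ?divr_gt0 //.
exact/ltW/truncnS_gt.
Qed.

(** Closeness along the whole flow line makes all heights of suitable lifts close at once, since the
    flow can carry any chosen height into the window. Separation by Birkhoff sums then forces equal
    base points, and the remaining height difference is the time shift. *)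
Lemma sus_kinematic_expansive (eta : R) (d : sus_space f T -> sus_space f T -> R) :
  compact [set: Y] -> 0 < eta ->
  (forall x y, (forall k, `|height k (x, 0) - height k (y, 0)| < eta) -> x = y) ->
  compatible_metric d -> kinematic_expansive d (sus f T).
Proof.
move=> cY eta0 sep cd eps eps0.
(* The three bounds serve, in order, the comparison of two height differences, the size of the time
   shift, and the persistence of the lift. *)
pose e := Num.min (eta / 2) (Num.min eps (c / 4)).
have e0 : 0 < e by rewrite !lt_min eps0 !divr_gt0.
have [e1 e2 e3] : [/\ e <= eta / 2, e <= eps & e <= c / 4].
  by rewrite /e !ge_min !lexx !orbT.
have [delta delta0 H] :=
  compact_metric_unif (sus_space_compact cY) cd sus_dist_compatible e0.
exists delta => // a b ab.
rewrite -[a]reprK -[b]reprK in ab *; set p := repr a in ab *; set q0 := repr b in ab *.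
have {}ab t := H _ _ (ab t).
have : sus_dist (\pi_(sus_space f T)%qT p) (\pi_(sus_space f T)%qT q0) < e.
  by have := ab 0; rewrite !flow_map0.
move=> /(orbit_dist_ltP cover_dist_compatible cover_dist_deck)[n].
have qE : \pi_(sus_space f T)%qT q0 = \pi_(sus_space f T)%qT (homeo_iter dk n q0).
  by apply/orbit_spaceP; exists n.
rewrite qE in ab *; set q := homeo_iter dk n q0 in ab * => pq.
have close : forall t, cover_dist (translation t p) (translation t q) < e.
  by apply: lift_stays_close => //; lra.
have hclose m : `|height m p - height m q| < e.
  (* At this time the [m]-th height of [p] equals [C], which lies in the window. *)
  have := close (C - height m p); have cC := le_trans (cT p.1) (TC p.1).
  move=> /(@cover_dist_height m); rewrite !height_translation addrC subrK.
  have -> : C - (height m q + (C - height m p)) = height m p - height m q by ring.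
  by apply; rewrite ?lexx //=; lra.
have pq1 : p.1 = q.1.
  (* Subtracting the heights at index 0 removes the starting heights and leaves Birkhoff sums, at
     the cost of a factor 2. *)
  apply: sep => k; have := hclose 0; have := hclose k.
  have h0 r : height 0 r = r.2 by [].
  rewrite (heightE k p) (heightE k q) !h0 !ltr_norml /= => /andP[? ?] /andP[? ?]; apply/andP; split; lra.
exists (q.2 - p.2).
  have : `|p.2 - q.2| < e := hclose 0.
  by rewrite ltr_norml => /andP[? ?]; apply/andP; split; lra.
by rewrite /= sus_mapE /translation pq1 addrC subrK -surjective_pairing.
Qed.

End SusMetric.

(** * The circle *)

Section SinPi.
Context {R : realType}.
Implicit Types (x y r : R) (k : int).

Lemma sin_pi_int k : sin (pi * k%:~R) = 0 :> R.
Proof.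
have nat_case (n : nat) : sin (pi * n%:R) = 0 :> R.
  elim: n => [|n IH]; first by rewrite mulr0 sin0.
  by rewrite -natr1 mulrDr mulr1 sinDpi IH oppr0.
case: k => n; first exact: nat_case.
by rewrite NegzE mulrNz mulrN sinN nat_case oppr0.
Qed.

Lemma norm_sin_pi_periodic x k : `|sin (pi * (x + k%:~R))| = `|sin (pi * x)|.
Proof.
have sk := sin_pi_int k.
by rewrite mulrDr sinD sk mulr0 addr0 normrM (sin0cos1 sk) mulr1.
Qed.

Lemma cos_2pi_periodic x k : cos (2 * pi * (x + k%:~R)) = cos (2 * pi * x).
Proof.
have -> : 2 * pi * (x + k%:~R) = 2 * pi * x + (pi * k%:~R) *+ 2 by rewrite -mulr_natl; ring.
rewrite cosD cos_mulr2n sin_mulr2n cos2sin2 sin_pi_int expr0n /=.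
by rewrite subr0 mulr0 mul0rn mulr0 subr0 mulr2n addrK mulr1.
Qed.

Lemma norm_sinD x y : `|sin (x + y)| <= `|sin x| + `|sin y|.
Proof.
rewrite sinD (le_trans (ler_normD _ _)) // !normrM.
by rewrite lerD // ?ler_piMr ?ler_piMl ?normr_ge0 ?cos_max.
Qed.

Lemma norm_sin_le x : `|sin x| <= `|x|.
Proof.
wlog x0 : x / 0 <= x => [H|].
  have [/H//|x0] := leP 0 x; rewrite -(normrN x) -(normrN (sin x)) -sinN.
  by apply: H; lra.
have [y _] := @MVT_segment R (@sin R) cos 0 x x0 (fun y _ => is_derive_sin y)
  (continuous_subspaceT (@continuous_sin R)).
rewrite sin0 !subr0 => ->; rewrite normrM ler_piMl ?normr_ge0 //; exact: cos_max.
Qed.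

Lemma norm_sin_pi x : `|x| <= 1 -> `|sin (pi * x)| = sin (pi * `|x|).
Proof.
wlog x0 : x / 0 <= x => [H x1|].
  have [/H->//|x0] := leP 0 x; rewrite -(normrN x) -(normrN (sin _)) -sinN -mulrN.
  by apply: H; rewrite ?normrN //; lra.
rewrite (ger0_norm x0) => x1; apply/ger0_norm/sin_ge0_pi.
by have := @pi_gt0 R => ?; apply/andP; split; nra.
Qed.

Lemma norm_sin_pi_lt x r : `|x| <= 1 / 2 -> 0 <= r <= 1 / 2 ->
  `|sin (pi * x)| < sin (pi * r) -> `|x| < r.
Proof.
move=> x1 /andP[r0 r1]; rewrite norm_sin_pi; last lra.
have p0 := @pi_gt0 R; have x0 := normr_ge0 x.
by rewrite (@ltr_sin R) ?ltr_pM2l // !in_itv /=; apply/andP; split; nra.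
Qed.

Lemma sin_pi_gt0 r : 0 < r <= 1 / 2 -> 0 < sin (pi * r).
Proof.
move=> /andP[r0 r1]; apply: sin_gt0_pi.
by have := @pi_gt0 R => ?; apply/andP; split; nra.
Qed.

Lemma near_int x : exists k, `|x + k%:~R| <= 1 / 2.
Proof.
exists (- Num.floor (x + 1 / 2)); rewrite mulrNz ler_norml.
have /andP[] := floor_itv (x + 1 / 2); rewrite intrD => ? ?.
by apply/andP; split; lra.
Qed.

Lemma sin_pi_eq0 x : sin (pi * x) = 0 -> x \is a Num.int.
Proof.
move=> sx; have [k xk] := near_int x.
apply/intrP; exists (- k); rewrite mulrNz; apply/eqP; rewrite eq_sym -subr_eq0.
rewrite -opprD oppr_eq0 addrC -normr_le0 leNgt; apply/negP => xk0.
have := @sin_pi_gt0 `|x + k%:~R|; rewrite xk0 xk => /(_ isT).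
by rewrite -norm_sin_pi; [rewrite norm_sin_pi_periodic sx normr0 ltxx|lra].
Qed.

End SinPi.

Section CircleMetric.
Variable R : realType.

Local Notation picirc := (\pi_(circle R)%qT).

Lemma circle_pi_int (x : R) (k : int) : picirc (x + k%:~R) = picirc x.
Proof. by apply/circleP; rewrite addrC addKr intr_int. Qed.

Lemma circle_lift (x : R) : exists k : int, repr (picirc x) = x + k%:~R.
Proof.
have /circleP/intrP[k kE] : picirc (repr (picirc x)) = picirc x by rewrite reprK.
by exists k; rewrite -kE addrC subrK.
Qed.

(** Half the chord between [e^(2 pi i x)] and [e^(2 pi i y)]: it is 1-periodic, hence independent of
    the representatives, and rotation invariant. *)
Definition circle_dist (x y : circle R) : R := `|sin (pi * (repr x - repr y))|.

Lemma circle_distE (x y : R) : circle_dist (picirc x) (picirc y) = `|sin (pi * (x - y))|.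
Proof.
rewrite /circle_dist; have [k ->] := circle_lift x; have [l ->] := circle_lift y.
rewrite opprD addrACA -intrB; exact: norm_sin_pi_periodic.
Qed.

Lemma circle_dist_compatible : compatible_metric circle_dist.
Proof.
split.
  split.
  - move=> x y; split => [/normr0_eq0/sin_pi_eq0 xy|->].
      by rewrite -[x]reprK -[y]reprK; apply/circleP.
    by rewrite /circle_dist subrr mulr0 sin0 normr0.
  - by move=> x y; rewrite /circle_dist -opprB mulrN sinN normrN.
  - move=> x y z; rewrite /circle_dist.
    have -> : repr x - repr z = repr x - repr y + (repr y - repr z) by ring.
    by rewrite mulrDr; exact: norm_sinD.
move=> A; rewrite [open A](_ : _ = open (picirc @^-1` A)) // openE.
split.
  move=> oA x; rewrite -[x]reprK; set x' := repr x => Ax.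
  have /nbhs_ballP[r /= r0 rA] := oA x' Ax.
  have r'0 : 0 < Num.min r (1 / 2) <= 1 / 2.
    by rewrite lt_min r0 ge_min lexx orbT divr_gt0.
  exists (sin (pi * Num.min r (1 / 2))); first exact: sin_pi_gt0.
  move=> y /=; rewrite -[y]reprK circle_distE => xy.
  have [k kxy] := near_int (x' - repr y).
  have : `|x' - repr y + k%:~R| < Num.min r (1 / 2).
    apply: norm_sin_pi_lt => //; last by rewrite norm_sin_pi_periodic.
    by case/andP: r'0 => /ltW -> ->.
  rewrite lt_min => /andP[xr _].
  rewrite -(circle_pi_int _ (- k)); apply: (rA (repr y + (- k)%:~R)).
  by rewrite /ball /= mulrNz opprD opprK addrA.
move=> oA x /= Ax; have [e e0 eA] := oA _ Ax.
apply: filterS (_ : nbhs x [set y | `|sin (pi * (x - y))| < e]).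
  by move=> y /= xy; apply: eA; rewrite /= circle_distE.
have cs : {for x, continuous (fun y : R => sin (pi * (x - y)))}.
  apply: continuous_comp; last exact: continuous_sin.
  by apply: cvgM; [exact: cvg_cst|apply: cvgB; [exact: cvg_cst|exact: cvg_id]].
have /cvgrPdist_lt/(_ _ e0) := cs.
rewrite subrr mulr0 sin0; apply: filterS => y.
by rewrite /= sub0r normrN.
Qed.

Lemma circle_dist_rotation a x y :
  circle_dist (rotation a x) (rotation a y) = circle_dist x y.
Proof.
rewrite -[x]reprK -[y]reprK /= /rotation_fun -!circle_piD !circle_distE.
by congr `|sin (pi * _)|; ring.
Qed.

Lemma circle_compact : compact [set: circle R].
Proof.
have -> : [set: circle R] = picirc @` `[(-1 : R), 1].
  apply/seteqP; split=> // x _; rewrite -[x]reprK; have [k] := near_int (repr x).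
  rewrite ler_norml => /andP[? ?]; exists (repr x + k%:~R); last exact: circle_pi_int.
  by rewrite /= in_itv /=; apply/andP; split; lra.
apply: continuous_compact; last exact: segment_compact.
by apply: continuous_subspaceT => x; exact: pi_continuous.
Qed.

End CircleMetric.

(** * Averages of trigonometric sequences *)

Section Averages.
Context {R : realType}.

Lemma le0_of_bounded_multiples (x M : R) : (forall N : nat, N%:R * x <= M) -> x <= 0.
Proof.
move=> H; rewrite leNgt; apply/negP => x0.
have := truncnS_gt (`|M| / x); rewrite ltr_pdivrMr // => MN.
have := H (Num.truncn (`|M| / x)).+1; have := ler_norm M; lra.
Qed.

(** A quantitative form of having zero mean, which avoids limits of averages;
    [le0_of_bounded_multiples] replaces division by [N]. *)
Definition bounded_sums (u : nat -> R) : Prop :=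
  exists M : R, forall N : nat, `|\sum_(i < N) u i| <= M.

Lemma bounded_sumsD u v : bounded_sums u -> bounded_sums v ->
  bounded_sums (fun i => u i + v i).
Proof.
move=> [M HM] [M' HM']; exists (M + M') => N; rewrite big_split /=.
by apply: le_trans (ler_normD _ _) _; apply: lerD; [exact: HM|exact: HM'].
Qed.

Lemma bounded_sumsZ a u : bounded_sums u -> bounded_sums (fun i => a * u i).
Proof.
move=> [M HM]; exists (`|a| * M) => N.
by rewrite -mulr_sumr normrM ler_wpM2l.
Qed.

Lemma bounded_sums_sum (u : nat -> nat -> R) K :
  (forall j, (j < K)%N -> bounded_sums (u j)) ->
  bounded_sums (fun i => \sum_(j < K) u j i).
Proof.
elim: K => [|K IH] H.
  by exists 0 => N; rewrite big1 ?normr0 // => i _; rewrite big_ord0.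
have [M HM] := bounded_sumsD (IH (fun j jK => H j (ltnW jK))) (H K (ltnSn K)).
exists M => N; under eq_bigr do rewrite big_ord_recr /=.
exact: HM.
Qed.

Lemma bounded_sums_eq u v : u =1 v -> bounded_sums u -> bounded_sums v.
Proof. by move=> /funext ->. Qed.

(** Multiplied by [2 sin theta], each term becomes a difference of two sines and the sum
    telescopes. *)
Lemma bounded_sums_cos (theta psi : R) : sin theta != 0 ->
  bounded_sums (fun i => cos (2 * theta * i%:R + psi)).
Proof.
move=> s0; exists (`|sin theta|^-1) => N.
have tele : 2 * sin theta * \sum_(i < N) cos (2 * theta * i%:R + psi) =
    sin (2 * theta * N%:R - theta + psi) - sin (psi - theta).
  elim: N => [|N IH]; first by rewrite big_ord0 !mulr0 sub0r [- theta + _]addrC subrr.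
  rewrite big_ord_recr /= mulrDr IH.
  move: (sin (psi - theta)) => z.
  have -> : 2 * theta * N%:R - theta + psi = 2 * theta * N%:R + psi - theta by ring.
  have -> : 2 * theta * N.+1%:R - theta + psi = 2 * theta * N%:R + psi + theta.
    by rewrite -natr1; ring.
  by rewrite (sinB _ theta) (sinD _ theta); ring.
have t0 : 0 < `|sin theta| by rewrite normr_gt0.
have : `|2 * sin theta * \sum_(i < N) cos (2 * theta * i%:R + psi)| <= 2.
  rewrite tele; apply: le_trans (ler_normB _ _) _.
  by have := sin_max (2 * theta * N%:R - theta + psi); have := sin_max (psi - theta); lra.
rewrite !normrM (ger0_norm (ler0n _ 2)) -mulrA => H.
rewrite -[leRHS]mul1r ler_pdivlMr // mulrC; lra.
Qed.

(** Abel summation: the boundary term contributes [eta], and each of the [N] increments of the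
    weight at most [eta * W]. *)
Lemma summation_by_parts_bound (g w : nat -> R) (eta W : R) :
  (forall i, `|w i| <= 1) -> (forall i, `|w i.+1 - w i| <= W) ->
  (forall N, `|\sum_(i < N) g i| <= eta) ->
  forall N, `|\sum_(i < N) g i * w i| <= eta + N%:R * (eta * W).
Proof.
move=> w1 wW gN N; pose G N := \sum_(i < N) g i.
have -> : \sum_(i < N) g i * w i = G N * w N - \sum_(i < N) G i.+1 * (w i.+1 - w i).
  elim: N => [|N IH]; first by rewrite /G !big_ord0 mul0r subrr.
  have GS : G N.+1 = G N + g N by rewrite /G big_ord_recr.
  by rewrite !big_ord_recr /= IH GS; ring.
have eta0 : 0 <= eta := le_trans (normr_ge0 _) (gN 0%N).
apply: le_trans (ler_normB _ _) _; apply: lerD.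
  by rewrite normrM -[eta]mulr1 ler_pM // ?normr_ge0 // gN.
apply: le_trans (ler_norm_sum _ _ _) _.
rewrite mulr_natl -[in leRHS](card_ord N) -sumr_const; apply: ler_sum => i _.
by rewrite normrM ler_pM ?normr_ge0 // gN.
Qed.

Lemma norm_sin_shift (x y : R) : `|sin (x + 2 * y) - sin x| <= 2 * `|sin y|.
Proof.
have -> : sin (x + 2 * y) - sin x = 2 * sin y * cos (x + y).
  have -> : x + 2 * y = x + y + y by ring.
  by rewrite -{2}(addrK y x) (sinD (x + y)) (sinB (x + y)); ring.
rewrite !normrM (ger0_norm (ler0n _ 2)) -[leRHS]mulr1.
by rewrite ler_wpM2l ?cos_max // mulr_ge0.
Qed.

(* Averaging against [sin (2 pi m_J alpha i + psi J)] isolates the coefficient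
   [b J], while summation by parts bounds the average of a sequence with
   bounded partial sums. *)
Lemma trigonometric_coefficient_bound (alpha eta : R) (m : nat -> nat)
    (b psi : nat -> R) (g : nat -> R) :
  (forall k : int, k != 0 -> sin (pi * (k%:~R * alpha)) != 0) ->
  injective m -> (forall j, (0 < m j)%N) ->
  (forall e, 0 < e -> exists K0, forall K, (K0 <= K)%N -> forall i,
    `|g i - \sum_(j < K) b j * sin (2 * pi * ((m j)%:R * alpha) * i%:R + psi j)| <= e) ->
  (forall N, `|\sum_(i < N) g i| <= eta) ->
  forall J, `|b J| <= 4 * eta * `|sin (pi * ((m J)%:R * alpha))|.
Proof.
move=> irr mI m0 gE gN J.
pose s j i : R := sin (2 * pi * ((m j)%:R * alpha) * i%:R + psi j).
pose W := 2 * `|sin (pi * ((m J)%:R * alpha))|.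
have sW i : `|s J i.+1 - s J i| <= W.
  rewrite /s -[i.+1%:R]natr1.
  have -> : 2 * pi * ((m J)%:R * alpha) * (i%:R + 1) + psi J =
    2 * pi * ((m J)%:R * alpha) * i%:R + psi J + 2 * (pi * ((m J)%:R * alpha)) by ring.
  exact: norm_sin_shift.
have cosbs (k : int) phi : k != 0 -> bounded_sums (fun i => cos (2 * (pi * (k%:~R * alpha)) * i%:R + phi)).
  by move=> k0; apply: bounded_sums_cos; exact: irr.
(* Orthogonality of harmonics: the product is half the cosine at the difference frequency minus half
   that at the sum. The sum frequency is never zero and the difference vanishes only for [j = J],
   leaving the mean 1/2. *)
have prod_bs j (z : R) : z = (j == J)%:R / 2 -> bounded_sums (fun i => s j i * s J i - z).
  move=> ->; have plus := cosbs ((m j)%:Z + (m J)%:Z) (psi j + psi J) _.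
  have {}plus := bounded_sumsZ (- (1 / 2)) (plus ltac:(have := m0 J; lia)).
  have [jJ|jJ] := eqVneq j J.
    apply: bounded_sums_eq plus => i; rewrite jJ /s intrD.
    set A := 2 * pi * _ * _ + psi J; have -> : 2 * (pi * (((m J)%:Z%:~R + (m J)%:Z%:~R) * alpha)) * i%:R + (psi J + psi J) = A + A.
      by rewrite /A; ring.
    by rewrite cosD /= -!expr2 cos2sin2; lra.
  have minus := cosbs ((m j)%:Z - (m J)%:Z) (psi j - psi J) _.
  have mjJ : m j != m J by apply: contraNneq jJ => /mI ->.
  have {}minus := bounded_sumsZ (1 / 2) (minus ltac:(lia)).
  apply: bounded_sums_eq (bounded_sumsD minus plus) => i; rewrite /s intrB intrD.
  set A := 2 * pi * _ * _ + psi j; set B := 2 * pi * _ * _ + psi J.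
  have -> : 2 * (pi * (((m j)%:Z%:~R - (m J)%:Z%:~R) * alpha)) * i%:R + (psi j - psi J) = A - B.
    by rewrite /A /B; ring.
  have -> : 2 * (pi * (((m j)%:Z%:~R + (m J)%:Z%:~R) * alpha)) * i%:R + (psi j + psi J) = A + B.
    by rewrite /A /B; ring.
  by rewrite (cosB A B) (cosD A B) /= mul0r subr0; field.
suff : `|b J| / 2 - eta * W <= 0 by rewrite /W; lra.
apply/ler_addgt0Pr => e e0; rewrite add0r.
(* The truncation is taken long enough to contain the harmonic [J]. *)
have [K0 /(_ (maxn K0 J.+1) (leq_maxl _ _))] := gE e e0.
set K := maxn K0 J.+1 => gK; have JK : (J < K)%N by rewrite leq_maxr.
have [M HM] : bounded_sums (fun i => (\sum_(j < K) b j * s j i) * s J i - b J / 2).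
  have bs j : (j < K)%N -> bounded_sums (fun i => b j * (s j i * s J i - (j == J)%:R / 2)).
    by move=> _; apply: bounded_sumsZ; exact: prod_bs.
  apply: bounded_sums_eq (bounded_sums_sum bs) => i.
  rewrite (eq_bigr (fun j : 'I_K => b j * s j i * s J i - b j * ((val j == J)%:R / 2))); last first.
    by move=> j _; rewrite mulrBr mulrA.
  rewrite sumrB mulr_suml; congr (_ - _).
  rewrite (bigD1 (Ordinal JK)) //= eqxx mul1r big1 ?addr0 // => j.
  by rewrite -val_eqE /= => /negPf ->; rewrite mul0r mulr0.
suff : `|b J| / 2 - eta * W - e <= 0 by lra.
apply: (@le0_of_bounded_multiples _ (M + eta)) => N.
have gw := summation_by_parts_bound (fun i => sin_max _) sW gN N.
have rw : `|\sum_(i < N) (g i - \sum_(j < K) b j * s j i) * s J i| <= N%:R * e.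
  apply: le_trans (ler_norm_sum _ _ _) _.
  rewrite mulr_natl -[in leRHS](card_ord N) -sumr_const; apply: ler_sum => i _.
  rewrite normrM -[e]mulr1; apply: ler_pM; rewrite ?normr_ge0 ?sin_max //; exact: gK.
have := HM N; set S := \sum_(i < N) _ => SM.
(* The three terms are bounded by Abel summation, by the truncation error [N * e], and by the
   constant [M] from orthogonality. *)
have bN : N%:R * (b J / 2) =
    \sum_(i < N) g i * s J i - \sum_(i < N) (g i - \sum_(j < K) b j * s j i) * s J i - S.
  rewrite /S -!sumrB mulr_natl -[in LHS](card_ord N) -sumr_const.
  by apply: eq_bigr => i _; ring.
have : N%:R * (`|b J| / 2) <= eta + N%:R * (eta * W) + N%:R * e + M.
  have -> : N%:R * (`|b J| / 2) = `|N%:R * (b J / 2)|.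
    by rewrite !normrM normfV normr_nat (ger0_norm (ler0n _ 2)).
  rewrite bN; apply: le_trans (ler_normB _ _) _; apply: lerD => //.
  by apply: le_trans (ler_normB _ _) _; apply: lerD.
lra.
Qed.

End Averages.

(** * The return time *)

Section LacunarySeries.
Context {R : realType}.

Lemma geometric_majorant (u : nat -> R) (z : R) : 0 <= z < 1 ->
  (forall j, `|u j| <= z ^+ j) ->
  exists l : R, forall K, `|l - \sum_(j < K) u j| <= z ^+ K / (1 - z).
Proof.
move=> /andP[z0 z1] uz; have z1' : 0 < 1 - z by rewrite subr_gt0.
have /cvg_ex[l cl] : cvgn (series u).
  apply: normed_cvg; apply: (series_le_cvg (v_ := fun n => z ^+ n)) => [n|n|n|].
  - exact: normr_ge0.
  - exact: exprn_ge0.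
  - exact: uz.
  by rewrite exprn_geometric; apply: is_cvg_geometric_series; rewrite ger0_norm.
exists l => K; apply/ler_addgt0Pr => e e0.
have tail d : `|\sum_(j < K + d) u j - \sum_(j < K) u j| <= (z ^+ K - z ^+ (K + d)) / (1 - z).
  elim: d => [|d IH]; first by rewrite addn0 !subrr normr0 mul0r.
  rewrite addnS big_ord_recr /= addrAC (le_trans (ler_normD _ _)) //.
  have -> : (z ^+ K - z ^+ (K + d).+1) / (1 - z) =
      (z ^+ K - z ^+ (K + d)) / (1 - z) + z ^+ (K + d).
    by rewrite exprS; field; rewrite gt_eqF.
  by apply: lerD.
have /cvgrPdist_lt/(_ e e0)[N _ NP] := cl.
have /NP/= : (N <= K + N)%N by rewrite leq_addl.
rewrite /series /= big_mkord => lN.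
have tK : (z ^+ K - z ^+ (K + N)) / (1 - z) <= z ^+ K / (1 - z).
  by rewrite ler_pM2r ?invr_gt0 // gerBl exprn_ge0.
have := ler_distD (\sum_(j < K + N) u j) l (\sum_(j < K) u j).
have := tail N; lra.
Qed.

Lemma geometric_small (z e : R) : 0 <= z < 1 -> 0 < e ->
  exists K0, forall K, (K0 <= K)%N -> z ^+ K < e.
Proof.
move=> /andP[z0 z1] e0.
have z1' : `|z| < 1 by rewrite ger0_norm.
have /cvgrPdist_lt/(_ e e0)[N _ NP] := cvg_expr z1'.
exists N => K /NP; rewrite /= sub0r normrN ger0_norm ?exprn_ge0 //.
Qed.

(** The sum is chosen on representatives; as the frequencies are integers, the estimate passes to
    every lift. Its uniformity in [x] gives continuity. *)
Lemma lacunary_series (z : R) (m : nat -> nat) : 0 <= z < 1 ->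
  exists2 S : circle R -> R, continuous S & forall x K,
    `|S (\pi_(circle R)%qT x) - \sum_(j < K) z ^+ j * cos (2 * pi * ((m j)%:R * x))|
      <= z ^+ K / (1 - z).
Proof.
move=> zz; have /andP[z0 z1] := zz; have z1' : 0 < 1 - z by rewrite subr_gt0.
have pick (x : circle R) : exists l : R, forall K,
    `|l - \sum_(j < K) z ^+ j * cos (2 * pi * ((m j)%:R * repr x))| <= z ^+ K / (1 - z).
  apply: (@geometric_majorant (fun j => z ^+ j * cos (2 * pi * ((m j)%:R * repr x)))) => // j.
  by rewrite normrM ger0_norm ?exprn_ge0 // ler_piMr ?exprn_ge0 // cos_max.
have [S SP] := choice pick.
have SE x K : `|S (\pi_(circle R)%qT x) - \sum_(j < K) z ^+ j * cos (2 * pi * ((m j)%:R * x))|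
      <= z ^+ K / (1 - z).
  have := SP (\pi_(circle R)%qT x) K; have [k ->] := circle_lift x.
  congr (`|_ - _| <= _); apply: eq_bigr => j _.
  have -> : (m j)%:R * (x + k%:~R) = (m j)%:R * x + ((m j)%:Z * k)%:~R :> R.
    by rewrite mulrDr intrM.
  by rewrite cos_2pi_periodic.
exists S => //; apply/quotient_continuous => x /=.
apply/cvgrPdist_lt => e e0.
have e30 : 0 < e / 3 by rewrite divr_gt0.
have [K /(_ K (leqnn K)) zK] := geometric_small zz (mulr_gt0 e30 z1').
have tK : z ^+ K / (1 - z) < e / 3 by rewrite ltr_pdivrMr.
pose P (y : R) := \sum_(j < K) z ^+ j * cos (2 * pi * ((m j)%:R * y)).
have cP : {for x, continuous P}.
  apply: continuous_big => [|j _]; first exact: add_continuous.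
  move=> y; apply: cvgM; first exact: cvg_cst.
  apply: (@continuous_comp _ _ _ (fun y : R => 2 * pi * ((m j)%:R * y)) cos); last exact: continuous_cos.
  by apply: cvgM; [exact: cvg_cst|apply: cvgM; [exact: cvg_cst|exact: cvg_id]].
near=> y.
have Pxy : `|P x - P y| < e / 3.
  by near: y; have /cvgrPdist_lt := cP; exact.
have := SE x K; have := SE y K; rewrite -/(P x) -/(P y) distrC /= => Sy Sx.
set Sx' := S _; set Sy' := S _.
have := ler_distD (P x) Sx' Sy'; have := ler_distD (P y) (P x) Sy'.
by rewrite /Sx' /Sy'; lra.
Unshelve. all: end_near.
Qed.

End LacunarySeries.

(* The indexing is shifted, [fib n] being the Fibonacci number F_(n+2), so that
   [fib] is injective. *)
Fixpoint fib (n : nat) : nat :=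
  match n with
  | 0 => 1
  | 1 => 2
  | (n''.+1 as n').+1 => fib n' + fib n''
  end.

Lemma fibSS n : fib n.+2 = (fib n.+1 + fib n)%N.
Proof. by []. Qed.

Lemma fib_gt0 n : (0 < fib n)%N.
Proof. by elim/ltn_ind: n => -[|[|n]] IH //; rewrite fibSS addn_gt0 IH. Qed.

Lemma fib_lt n : (fib n < fib n.+1)%N.
Proof. by case: n => [|n] //; rewrite fibSS -addn1 leq_add2l fib_gt0. Qed.

Lemma fib_double n : (fib n.+1 <= 2 * fib n)%N.
Proof. by case: n => [|n] //; rewrite fibSS; have := fib_lt n; lia. Qed.

Lemma fib_ge n : (n < fib n)%N.
Proof. by elim: n => [|n IH] //; exact: leq_ltn_trans (fib_lt n). Qed.

Lemma fib_inj : injective fib.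
Proof. exact: incn_inj (leq_mono (homo_ltn ltn_trans fib_lt)). Qed.

(** * The golden mean and its Fibonacci approximations *)

Section Golden.
Context {R : realType}.

Definition golden : R := (Num.sqrt 5 - 1) / 2.

Lemma golden_sqr : golden ^+ 2 = 1 - golden.
Proof.
have s5 : Num.sqrt (5 : R) ^+ 2 = 5 by rewrite sqr_sqrtr.
by rewrite /golden exprMn sqrrB s5 exprVn; field.
Qed.

Lemma golden_itv : 0 < golden < 1.
Proof.
have s5 : Num.sqrt (5 : R) ^+ 2 = 5 by rewrite sqr_sqrtr.
have s0 : 0 <= Num.sqrt (5 : R) by exact: sqrtr_ge0.
by rewrite /golden; apply/andP; split; nra.
Qed.

(** Otherwise the relation [golden^(j+2) = golden^j - golden^(j+1)] makes every [k * golden^j] a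
    nonzero integer, although these tend to 0. *)
Lemma golden_not_int (k : int) : k != 0 -> ~~ (k%:~R * golden \is a Num.int).
Proof.
move=> k0; apply/negP => kg; have /andP[g0 g1] := golden_itv.
have pw j : (k%:~R * golden ^+ j \is a Num.int) && (k%:~R * golden ^+ j.+1 \is a Num.int).
  elim: j => [|j /andP[IH IH']]; first by rewrite expr0 mulr1 expr1 intr_int kg.
  rewrite IH' /=; have -> : golden ^+ j.+2 = golden ^+ j - golden ^+ j.+1.
    by rewrite -addn2 exprD golden_sqr exprS; ring.
  by rewrite mulrBr rpredB.
have k1 : 0 < `|k%:~R : R| by rewrite normr_gt0 intr_eq0.
have gg : 0 <= golden < 1 by rewrite g1 ltW.
have [K /(_ K (leqnn K)) gK] := geometric_small gg (divr_gt0 ltr01 k1).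
have /andP[ki _] := pw K.
have := norm_intr_ge1 ki; rewrite mulf_eq0 intr_eq0 negb_or k0 expf_eq0 gt_eqF // andbF.
move=> /(_ isT); rewrite normrM (ger0_norm (exprn_ge0 _ (ltW g0))).
by move: gK; rewrite ltr_pdivlMr // mulrC; lra.
Qed.

Lemma golden_irrational : irrational golden.
Proof.
move=> /rationalP[a [b ab]].
(* A zero denominator stands for the quotient 0, which positivity of [golden] excludes. *)
have [b0|b0] := eqVneq b 0%N.
  by have /andP[] := golden_itv; rewrite ab b0 invr0 mulr0 ltxx.
have /negP := @golden_not_int b%:Z b0; apply.
by rewrite ab /= mulrC divfK ?pnatr_eq0 // intr_int.
Qed.

Lemma sin_golden (k : int) : k != 0 -> sin (pi * (k%:~R * golden)) != 0.
Proof.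
by move=> k0; apply/eqP => /sin_pi_eq0; apply/negP; exact: golden_not_int.
Qed.

(** As [- golden] is a root of [X^2 = X + 1], its powers obey the Fibonacci recursion; so the
    integer parts [k] do as well, starting from 1 and 1. *)
Lemma fib_golden n : exists k : int, (fib n)%:R * golden = - (- golden) ^+ n.+2 + k%:~R.
Proof.
have gS : golden ^+ 2 = 1 - golden := golden_sqr.
have : (exists k : int, (fib n)%:R * golden = - (- golden) ^+ n.+2 + k%:~R) /\
       (exists k : int, (fib n.+1)%:R * golden = - (- golden) ^+ n.+3 + k%:~R); last by case.
elim: n => [|n [[k kE] [l lE]]]; last first.
  split; first by exists l.
  exists (k + l); rewrite fibSS natrD mulrDl lE kE intrD.
  have -> : (- golden) ^+ n.+4 = (- golden) ^+ n.+3 + (- golden) ^+ n.+2.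
    by rewrite -(addn2 n.+2) exprD sqrrN gS [in RHS]exprS; ring.
  ring.
split; exists 1; first by rewrite sqrrN gS /=; ring.
have -> : (- golden) ^+ 3 = 1 - 2 * golden.
  by rewrite exprS sqrrN gS mulrBr mulr1 mulNr opprK -expr2 gS; ring.
by rewrite /=; ring.
Qed.

Lemma norm_sin_fib_golden n : `|sin (pi * ((fib n)%:R * golden))| <= pi * golden ^+ n.
Proof.
have [k ->] := fib_golden n; have /andP[g0 g1] := golden_itv.
rewrite norm_sin_pi_periodic mulrN sinN normrN.
apply: le_trans (norm_sin_le _) _.
rewrite normrM normrX normrN (gtr0_norm (pi_gt0 R)) (gtr0_norm g0).
rewrite ler_pM2l ?pi_gt0 // -addn2 exprD ler_piMr ?exprn_ge0 ?(ltW g0) //.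
by rewrite expr_le1 // ltW.
Qed.

End Golden.

(** * Separation of points of the circle by Birkhoff sums *)

Section Separation.
Context {R : realType}.

Local Notation picirc := (\pi_(circle R)%qT).
Local Notation g := (@golden R).

Lemma fib_sin_separates (h : R) : `|h| <= 1 / 2 ->
  (forall j, `|sin (pi * ((fib j)%:R * h))| < sin (pi * (1 / 4))) -> h = 0.
Proof.
move=> h1 sj.
(* Doubling only gives the bound 1/2, but below 1/2 the sine is increasing and the hypothesis
   restores 1/4. *)
have quarter j : (fib j)%:R * `|h| < 1 / 4.
  have fj i : (fib i)%:R * `|h| = `|(fib i)%:R * h| by rewrite normrM normr_nat.
  have q : 0 <= (1 / 4 : R) <= 1 / 2 by apply/andP; split; lra.
  elim: j => [|j IH]; rewrite fj; apply: (norm_sin_pi_lt _ q) => //.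
  - by rewrite -fj /= [_ * `|h|]mul1r.
  - rewrite -fj; have : (fib j.+1)%:R * `|h| <= (2 * fib j)%:R * `|h|.
      by rewrite ler_wpM2r // ler_nat fib_double.
    by rewrite natrM -mulrA; lra.
apply/eqP; rewrite -normr_le0; apply: (@le0_of_bounded_multiples _ _ (1 / 4)) => N.
apply: le_trans (ltW (quarter N)).
by rewrite ler_wpM2r // ler_nat ltnW // fib_ge.
Qed.

(** Chosen to turn the bound [4 * eta * pi * golden^J] on the [J]-th coefficient into
    [sin (pi / 4) * golden^J]. *)
Definition separation_gap : R := sin (pi * (1 / 4)) / (4 * pi).

Lemma separation_gap_gt0 : 0 < separation_gap.
Proof. by rewrite divr_gt0 ?mulr_gt0 ?pi_gt0 // sin_pi_gt0 //; apply/andP; split; lra. Qed.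

Lemma separation_gapE : 4 * separation_gap * pi = sin (pi * (1 / 4)).
Proof.
have := lt0r_neq0 (@pi_gt0 R); rewrite /separation_gap.
by move: (sin _) => s; move: (@pi R) => p p0; field.
Qed.

Lemma birkhoff_separation (S : circle R -> R) (x h : R) :
  (forall x K, `|S (picirc x) - \sum_(j < K) g ^+ j * cos (2 * pi * ((fib j)%:R * x))|
      <= g ^+ K / (1 - g)) ->
  `|h| <= 1 / 2 ->
  (forall N, `|\sum_(i < N) (S (picirc (x + h + i%:R * g)) - S (picirc (x + i%:R * g)))|
      <= separation_gap) ->
  h = 0.
Proof.
move=> SE h1 gap; have /andP[g0 g1] := @golden_itv R.
have g1' : 0 < 1 - g by rewrite subr_gt0.
(* From [cos (A + y) - cos (A - y) = - 2 sin A sin y], where [y = pi m_j h] and [A] is the phase at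
   the midpoint of the two orbit points. *)
pose b j := - 2 * g ^+ j * sin (pi * ((fib j)%:R * h)).
pose psi j := 2 * pi * ((fib j)%:R * x) + pi * ((fib j)%:R * h).
have approx e : 0 < e -> exists K0, forall K, (K0 <= K)%N -> forall i : nat,
    `|S (picirc (x + h + i%:R * g)) - S (picirc (x + i%:R * g))
      - \sum_(j < K) b j * sin (2 * pi * ((fib j)%:R * g) * i%:R + psi j)| <= e.
  move=> e0; have gg : 0 <= g < 1 by rewrite g1 ltW.
  have [K0 K0P] := geometric_small gg (mulr_gt0 (divr_gt0 e0 (ltr0n R 2)) g1').
  exists K0 => K /K0P gK i; have tK : g ^+ K / (1 - g) < e / 2 by rewrite ltr_pdivrMr.
  have -> : \sum_(j < K) b j * sin (2 * pi * ((fib j)%:R * g) * i%:R + psi j) =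
      \sum_(j < K) g ^+ j * cos (2 * pi * ((fib j)%:R * (x + h + i%:R * g)))
      - \sum_(j < K) g ^+ j * cos (2 * pi * ((fib j)%:R * (x + i%:R * g))).
    rewrite -sumrB; apply: eq_bigr => j _; rewrite /b /psi.
    set y := pi * ((fib j)%:R * h); set A := 2 * pi * _ * _ + _.
    have -> : 2 * pi * ((fib j)%:R * (x + h + i%:R * g)) = A + y by rewrite /A /y; ring.
    have -> : 2 * pi * ((fib j)%:R * (x + i%:R * g)) = A - y by rewrite /A /y; ring.
    by rewrite (cosB A) (cosD A); ring.
  have := SE (x + h + i%:R * g) K; have := SE (x + i%:R * g) K.
  set s1 := S _; set s2 := S _; set t1 := \sum_(j < K) _; set t2 := \sum_(j < K) _.
  have -> : s2 - s1 - (t2 - t1) = (s2 - t2) - (s1 - t1) by ring.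
  have := ler_normB (s2 - t2) (s1 - t1); lra.
apply: fib_sin_separates => // J.
have := trigonometric_coefficient_bound (@sin_golden R) fib_inj fib_gt0 approx gap J.
have gJ : 0 < g ^+ J by rewrite exprn_gt0.
have p0 := @pi_gt0 R; have gap0 := separation_gap_gt0.
have k0 : 0 < sin (pi * (1 / 4) : R) by rewrite sin_pi_gt0 //; apply/andP; split; lra.
rewrite /b !normrM normrN (ger0_norm (ler0n R 2)) (gtr0_norm gJ) => bJ.
have : 4 * separation_gap * `|sin (pi * ((fib J)%:R * g))| <=
    4 * separation_gap * (pi * g ^+ J).
  by apply: ler_wpM2l; [lra|exact: norm_sin_fib_golden].
rewrite (mulrA _ pi) separation_gapE.
move=> /(le_trans bJ) sJ.
suff : 2 * `|sin (pi * ((fib J)%:R * h))| <= sin (pi * (1 / 4)) by lra.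
(* The weight of the harmonic and the bound on its small divisor share the factor [g^J], which
   cancels; hence the estimate is uniform in [J]. *)
rewrite -(ler_pM2r gJ); lra.
Qed.

Lemma rotation_iter (a x : R) k :
  iter k (rotation a) (picirc x) = picirc (x + k%:R * a).
Proof.
elim: k => [|k IH]; first by rewrite mul0r addr0.
by rewrite /= IH /= /rotation_fun -circle_piD -natr1 mulrDl mul1r addrA.
Qed.

Lemma height_rotation (a : R) (T : continuousType (circle R) R) (x : R) (N : nat) :
  height (rotation a) T N%:Z (picirc x, 0) =
  - \sum_(i < N) T (picirc (x + i%:R * a)).
Proof.
have fst_iter k : (homeo_iter (deck (rotation a) T) k%:Z (picirc x, 0)).1 =
    picirc (x + k%:R * a).
  rewrite -rotation_iter; elim: k => //= k IH.
  by rewrite IH.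
elim: N => [|N IH]; first by rewrite big_ord0 oppr0.
have -> : N.+1%:Z = N%:Z + 1 by lia.
by rewrite heightS IH fst_iter big_ord_recr /= opprD.
Qed.

End Separation.

Theorem theorem1p2 (R : realType) :
  exists (alpha : R) (T : continuousType (circle R) R),
    [/\ irrational alpha,
        forall x : circle R, 0 < T x,
        exists d : sus_space (rotation alpha) T -> sus_space (rotation alpha) T -> R,
          compatible_metric d
      & forall d : sus_space (rotation alpha) T -> sus_space (rotation alpha) T -> R,
          compatible_metric d -> kinematic_expansive d (sus (rotation alpha) T)].
Proof.
have /andP[g0 g1] := @golden_itv R.
have gg : 0 <= (golden : R) < 1 by rewrite g1 ltW.
have [S cS SE] := lacunary_series fib gg.
(* This is the series estimate with the empty partial sum. Adding [B + 1] places the return time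
   between 1 and [2 * B + 1], and the constant cancels in differences of Birkhoff sums. *)
pose B : R := 1 / (1 - golden).
have SB x : `|S x| <= B.
  by have := SE (repr x) 0%N; rewrite reprK big_ord0 subr0 expr0.
pose T0 (x : circle R) : R := S x + (B + 1).
have cT0 : continuous T0.
  by move=> x; exact: (cvgD (cS x) (cvg_cst _)).
pose T : continuousType (circle R) R := HB.pack T0 (isContinuous.Build _ _ T0 cT0).
have T1 x : 1 <= T x by have := SB x; rewrite ler_norml /= /T0 => /andP[? ?]; lra.
have T2 x : T x <= 2 * B + 1 by have := SB x; rewrite ler_norml /= /T0 => /andP[? ?]; lra.
exists golden, T; split.
- exact: golden_irrational.
- by move=> x; exact: lt_le_trans ltr01 (T1 x).
- exists (@sus_dist R (circle R) (rotation golden) T (@circle_dist R) (2 * B + 1)).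
  exact: (sus_dist_compatible ltr01 T1 T2 (circle_dist_compatible R)
    (@circle_dist_rotation R golden)).
move=> d cd; apply: (sus_kinematic_expansive ltr01 T1 T2 (circle_dist_compatible R)
    (@circle_dist_rotation R golden) (@circle_compact R) (@separation_gap_gt0 R)) => //.
move=> x y; rewrite -[x]reprK -[y]reprK; set x' := repr x; set y' := repr y.
(* The lift of [y] is moved by an integer to within 1/2 of [x'], as the doubling argument
   requires. *)
have [k kh] := near_int (y' - x').
rewrite -(circle_pi_int y' k) => close.
suff h0 : y' - x' + k%:~R = 0.
  by congr (\pi_(circle R)%qT _); lra.
apply: (birkhoff_separation SE kh (x := x')) => N.
have := close N; rewrite !height_rotation opprK addrC -sumrB => /ltW.
congr (`|_| <= _); apply: eq_bigr => i _.
have -> : x' + (y' - x' + k%:~R) = y' + k%:~R by ring.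
by rewrite /= /T0; ring.
Qed.
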